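(* Let $n\ge m$ be positive integers and let $f:\mathbb{R}^{m\times n}\to\mathbb{R}$ satisfy the standing assumptions listed in the context, including a global Polyak-Łojasiewicz inequality with constant $\mu>0$. Consider the preconditioned Nesterov iteration $$y_k=x_k+\beta(x_k-x_{k-1}),\qquad x_{k+1}=y_k-\alpha P_k^{-1}\nabla f(y_k),\qquad k\ge 0,$$ where the preconditioners $P_k\in\mathbb{R}^{m\times m}$ are symmetric positive definite and uniformly bounded, i.e. there are constants $p_{\max}>p_{\min}>0$ such that $p_{\min}I\preceq P_k\preceq p_{\max}I$ for all $k$. Then there exist $\beta^*\in(0,1)$ and a positive function $\alpha^*:[0,\beta^* )\to\mathbb{R}_{>0}$ such that for every $\beta\in[0,\beta^* )$ and every $\alpha\in(0,\alpha^*(\beta))$ the generated sequence satisfies $\lim_{k\to\infty}\|\nabla f(y_k)\|=0$ and, moreover, there exist constants $C>0$ and $\rho\in(0,1)$ such that $$f(x_k)-f^\star\le C\rho^k\qquad\text{for all }k\in\mathbb{N}.$$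
   Context: $\|\cdot\|$ and $\langle\cdot,\cdot\rangle$ denote the Frobenius norm and inner product on matrices, $\nabla f$ is the gradient with respect to this inner product, and $\preceq$ is the Loewner order. Standing assumptions on $f$: $f$ is differentiable and $L$-smooth for some $L>0$, i.e. $\|\nabla f(x)-\nabla f(y)\|\le L\|x-y\|$ for all $x,y$; $f$ is proper, meaning that preimages of compact sets are compact; $f$ is bounded below and attains its minimum value $f^\star$ at some finite point. The global Polyak-Łojasiewicz inequality with constant $\mu>0$ means $\|\nabla f(x)\|^2\ge\mu(f(x)-f^\star)$ for all $x\in\mathbb{R}^{m\times n}$. Conventions: $\alpha>0$ is the learning rate, $\beta\in[0,1)$ the momentum parameter; the matrices $P_k$ may vary with $k$ and may depend on the iterates; the bounds $p_{\min},p_{\max}$ are fixed before $\beta^*$ and $\alpha^*$, which may depend on $p_{\min},p_{\max}$ and $L$. The iteration starts from initial points $x_{-1},x_0\in\mathbb{R}^{m\times n}$. The constants $C$ and $\rho$ may depend on the initial points, $\alpha$ and $\beta$. *)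

(* Defs.v *)
From mathcomp Require Import all_boot all_order all_algebra.
From mathcomp Require Import all_classical all_reals all_analysis.
Set Implicit Arguments.
Unset Strict Implicit.
Unset Printing Implicit Defensive.
Import Order.TTheory GRing.Theory Num.Theory.
Import numFieldNormedType.Exports.
Local Open Scope classical_set_scope.
Local Open Scope ring_scope.

Definition frob_inner (R : realType) (m n : nat) (A B : 'M[R]_(m, n)) : R :=
  \tr (A *m B^T).

(* The norm `|A| that MathComp-Analysis puts on matrices is the maximum of the
   absolute values of the entries. It induces the same topology and the same
   differentials as the Frobenius norm, but it is not the Frobenius norm. *)
Definition frob_norm (R : realType) (m n : nat) (A : 'M[R]_(m, n)) : R :=
  Num.sqrt (frob_inner A A).

(* The Riesz representative of the differential for the Frobenius inner
   product. It is a junk value where [f] is not differentiable; elsewhere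
   [gradientP] below applies. *)
Definition gradient (R : realType) (m n : nat) (f : 'M[R]_(m, n) -> R)
    (x : 'M[R]_(m, n)) : 'M[R]_(m, n) :=
  xget 0 [set g | forall v, 'd f x v = frob_inner g v].

Definition proper_map (T U : topologicalType) (f : T -> U) : Prop :=
  forall K : set U, compact K -> compact (f @^-1` K).

Definition quad_form (R : realType) (m : nat) (A : 'M[R]_m) (v : 'cV[R]_m) : R :=
  (v^T *m A *m v) 0 0.

Definition spd (R : realType) (m : nat) (A : 'M[R]_m) : Prop :=
  A \is symmetricmx /\ forall v : 'cV[R]_m, v != 0 -> 0 < quad_form A v.

Definition loewner_le (R : realType) (m : nat) (A B : 'M[R]_m) : Prop :=
  (B - A) \is symmetricmx /\ forall v : 'cV[R]_m, 0 <= quad_form (B - A) v.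

(* [xm1] stands for x_{-1}, so [prev_iterate xm1 x k] is x_{k-1}. *)
Definition prev_iterate (T : Type) (xm1 : T) (x : nat -> T) (k : nat) : T :=
  if k is k'.+1 then x k' else xm1.

(* [P] is the sequence of preconditioners realized along the run, so it may
   depend on the iterates. *)
Definition nesterov_run (R : realType) (m n : nat) (f : 'M[R]_(m, n) -> R)
    (alpha beta : R) (P : nat -> 'M[R]_m) (xm1 : 'M[R]_(m, n))
    (x y : nat -> 'M[R]_(m, n)) : Prop :=
  forall k : nat,
    y k = x k + beta *: (x k - prev_iterate xm1 x k) /\
    x k.+1 = y k - alpha *: (invmx (P k) *m gradient f (y k)).

Lemma frob_innerE (R : realType) (m n : nat) (A B : 'M[R]_(m, n)) :
  frob_inner A B = \sum_i \sum_j A i j * B i j.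
Proof.
rewrite /frob_inner /mxtrace; apply: eq_bigr => i _.
by rewrite mxE; apply: eq_bigr => j _; rewrite mxE.
Qed.

Lemma gradientP (R : realType) (m n : nat) (f : 'M[R]_(m, n) -> R)
    (x : 'M[R]_(m, n)) : differentiable f x ->
  forall v, 'd f x v = frob_inner (gradient f x) v.
Proof.
move=> df; rewrite /gradient; case: xgetP => [_ -> //|nog].
exfalso; apply: (nog (\matrix_(i, j) 'd f x (delta_mx i j))) => v.
rewrite frob_innerE {1}(matrix_sum_delta v) linear_sum /=.
apply: eq_bigr => i _; rewrite linear_sum; apply: eq_bigr => j _.
by rewrite linearZ /= mxE mulrC.
Qed.

(* Main.v *)
Require Import Defs.
From mathcomp Require Import all_boot all_order all_algebra.
From mathcomp Require Import all_classical all_reals all_analysis.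
From mathcomp Require Import ring lra.
Import Order.TTheory GRing.Theory Num.Theory.
Import numFieldNormedType.Exports.
Local Open Scope classical_set_scope.
Local Open Scope ring_scope.

(** Let d = x_k - x_{k-1}, let g be the gradient at y_k and u the preconditioned
    gradient. The proof shows that the energy
      V k = f (x_k) - fstar + pmin / (8 alpha) * |d|^2
    contracts by a fixed factor at each step.

    The quadratic Taylor bounds of an L-smooth function at y_k
    ([smooth_taylor]), applied towards x_{k+1} and towards x_k, give
      f (x_{k+1}) <= f (x_k) + beta <g, d> - alpha <g, u>
                     + L/2 beta^2 |d|^2 + L/2 alpha^2 |u|^2,
    while |d_{k+1}|^2 = |beta d - alpha u|^2 is explicit. The bounds on the
    preconditioner turn the descent term <g, u> into control of both |g|^2 and
    |u|^2 ([loewner_le_frob], [loewner_sqr_frob]): half of it absorbs the terms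
    in |u|^2, the other half the cross term <g, d>. The weight 1 / alpha on the
    kinetic term makes every term scale alike: after Young's inequality at
    scale alpha, all of them are combinations of alpha |g|^2, alpha |u|^2 and
    |d|^2 / alpha with coefficients that depend on alpha only through the
    bounded quantity L alpha, so one threshold on beta works for all small
    alpha. The outcome ([nesterov_step]) is
      V (k+1) + delta (|g|^2 + |d|^2) <= V k.

    Conversely, the gradient at x_k differs from g by at most L beta |d|, so
    the Polyak-Lojasiewicz inequality at x_k gives V k <= K (|g|^2 + |d|^2).
    Hence V decays geometrically ([lyapunov_geometric]); it dominates both
    f (x_k) - fstar and delta |g|^2, which gives the two claims. *)

(** * The Frobenius inner product *)

Lemma frob_innerC {R : realType} {m n : nat} (A B : 'M[R]_(m, n)) :
  frob_inner A B = frob_inner B A.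
Proof.
rewrite !frob_innerE; apply: eq_bigr => i _.
by apply: eq_bigr => j _; rewrite mulrC.
Qed.

Lemma frob_innerDl {R : realType} {m n : nat} (A B C : 'M[R]_(m, n)) :
  frob_inner (A + B) C = frob_inner A C + frob_inner B C.
Proof. by rewrite /frob_inner mulmxDl mxtraceD. Qed.

Lemma frob_innerZl {R : realType} {m n : nat} (a : R) (A B : 'M[R]_(m, n)) :
  frob_inner (a *: A) B = a * frob_inner A B.
Proof. by rewrite /frob_inner -scalemxAl mxtraceZ. Qed.

Lemma frob_innerNl {R : realType} {m n : nat} (A B : 'M[R]_(m, n)) :
  frob_inner (- A) B = - frob_inner A B.
Proof. by rewrite -scaleN1r frob_innerZl mulN1r. Qed.

Lemma frob_innerDr {R : realType} {m n : nat} (A B C : 'M[R]_(m, n)) :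
  frob_inner C (A + B) = frob_inner C A + frob_inner C B.
Proof. by rewrite frob_innerC frob_innerDl !(frob_innerC C). Qed.

Lemma frob_innerZr {R : realType} {m n : nat} (a : R) (A B : 'M[R]_(m, n)) :
  frob_inner A (a *: B) = a * frob_inner A B.
Proof. by rewrite frob_innerC frob_innerZl frob_innerC. Qed.

Lemma frob_innerNr {R : realType} {m n : nat} (A B : 'M[R]_(m, n)) :
  frob_inner A (- B) = - frob_inner A B.
Proof. by rewrite frob_innerC frob_innerNl frob_innerC. Qed.

Definition frob_bilinear :=
  (@frob_innerDl, @frob_innerDr, @frob_innerNl, @frob_innerNr,
   @frob_innerZl, @frob_innerZr).

Lemma frob_inner_ge0 {R : realType} {m n : nat} (A : 'M[R]_(m, n)) :
  0 <= frob_inner A A.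
Proof.
rewrite frob_innerE; apply: sumr_ge0 => i _; apply: sumr_ge0 => j _.
exact: sqr_ge0.
Qed.

Lemma frob_norm_ge0 {R : realType} {m n : nat} (A : 'M[R]_(m, n)) :
  0 <= frob_norm A.
Proof. exact: sqrtr_ge0. Qed.

Lemma sqr_frob_norm {R : realType} {m n : nat} (A : 'M[R]_(m, n)) :
  frob_norm A ^+ 2 = frob_inner A A.
Proof. by rewrite sqr_sqrtr // frob_inner_ge0. Qed.

Lemma frob_normZ {R : realType} {m n : nat} (a : R) (A : 'M[R]_(m, n)) :
  frob_norm (a *: A) = `|a| * frob_norm A.
Proof.
by rewrite /frob_norm frob_innerZl frob_innerZr mulrA -expr2 sqrtrM
  ?sqr_ge0 // sqrtr_sqr.
Qed.

Lemma frob_inner_young {R : realType} {m n : nat} (A B : 'M[R]_(m, n)) :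
  2 * frob_inner A B <= frob_inner A A + frob_inner B B.
Proof.
have := frob_inner_ge0 (A - B).
by rewrite !frob_bilinear (frob_innerC B A); lra.
Qed.

Lemma frob_inner_addr_le {R : realType} {m n : nat} (A B : 'M[R]_(m, n)) :
  frob_inner (A + B) (A + B) <= 2 * frob_inner A A + 2 * frob_inner B B.
Proof.
have := frob_inner_young A B.
by rewrite !frob_bilinear (frob_innerC B A); lra.
Qed.

(** When B is nonzero, expand the squared norm of |B|^2 A - <A, B> B, which is
    |B|^2 times the projection of A orthogonal to B. *)
Lemma cauchy_schwarz_frob {R : realType} {m n : nat} (A B : 'M[R]_(m, n)) :
  frob_inner A B <= frob_norm A * frob_norm B.
Proof.
have [b0|b0] := eqVneq (frob_inner B B) 0; last first.
  have bp : 0 < frob_inner B B by rewrite lt_def b0 frob_inner_ge0.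
  have := frob_inner_ge0 (frob_inner B B *: A - frob_inner A B *: B).
  rewrite !frob_bilinear (frob_innerC B A).
  set a := frob_inner A A; set c := frob_inner A B; set b := frob_inner B B.
  move=> h; have {h}: 0 <= b * (a * b - c ^+ 2) by lra.
  rewrite pmulr_rge0 // subr_ge0 => h.
  rewrite /frob_norm -sqrtrM ?frob_inner_ge0 //.
  apply: (le_trans (ler_norm _)).
  by rewrite -sqrtr_sqr ler_sqrt // (le_trans _ h) ?sqr_ge0.
(* Here B has zero norm, so all its entries vanish. *)
suff -> : frob_inner A B = 0 by rewrite mulr_ge0 ?frob_norm_ge0.
have /eqP := b0; rewrite frob_innerE psumr_eq0; last first.
  by move=> i _; apply: sumr_ge0 => j _; apply: sqr_ge0.
move=> /allP h; rewrite frob_innerE big1 // => i _; rewrite big1 // => j _.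
have /= := h i (mem_index_enum _); rewrite psumr_eq0; last first.
  by move=> k _; apply: sqr_ge0.
move=> /allP /(_ j (mem_index_enum _)) /=.
by rewrite mulf_eq0 orbb => /eqP ->; rewrite mulr0.
Qed.

(** * Quadratic bounds for functions with Lipschitz gradient *)

(** The difference quotients of the restriction to a line are literally those
    of the directional derivative, so derivability along [v] carries over
    by definition. *)
Lemma is_derive_line {R : realType} {V : normedModType R} (f : V -> R)
    (x v : V) (t : R) : differentiable f (x + t *: v) ->
  is_derive t 1 (fun s : R => f (x + s *: v)) ('d f (x + t *: v) v).
Proof.
move=> df.
have quotE : (fun h : R => h^-1 *: (((fun s : R => f (x + s *: v)) \o shift t)
      (h *: 1) - f (x + t *: v))) =
    (fun h : R => h^-1 *: ((f \o shift (x + t *: v)) (h *: v)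
      - f (x + t *: v))).
  apply/funext => h /=.
  congr (_ *: (f _ - _)).
  by rewrite scalerDl /GRing.scale /= mulr1 addrCA.
split.
  by rewrite /derivable /= quotE; exact: diff_derivable.
by rewrite -deriveE // /derive quotE.
Qed.

(** Stated for scalars, so that computing the derivative never unfolds matrix
    operations in the expressions substituted for [F], [u], [w] and [z]. *)
Lemma is_derive_quadratic {R : realType} (F : R -> R) {u w z c s t : R} :
    is_derive t 1 F u ->
  is_derive t 1 (fun r : R => s * (F r - r * w) - c / 2 * z * r ^+ 2)
    (s * (u - w) - c * z * t).
Proof.
by move=> dF; apply: is_derive_eq; rewrite /GRing.scale /=; field.
Qed.

(** The sign [s] yields the upper and the lower Taylor bound at once. After
    moving the right-hand side to the left, the inequality compares the values
    at 1 and 0 of [phi] below, whose derivative is nonpositive by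
    Cauchy-Schwarz and the Lipschitz bound; the mean value theorem concludes. *)
Lemma smooth_taylor {R : realType} {m n : nat} (f : 'M[R]_(m, n) -> R) (L s : R)
    (f_diff : forall x : 'M[R]_(m, n), differentiable f x)
    (f_smooth : forall x y,
       frob_norm (gradient f x - gradient f y) <= L * frob_norm (x - y))
    (s1 : `|s| = 1) (x v : 'M[R]_(m, n)) :
  s * (f (x + v) - f x - frob_inner (gradient f x) v)
    <= L / 2 * frob_inner v v.
Proof.
set g := gradient f x.
pose phi t : R := s * (f (x + t *: v) - t * frob_inner g v)
  - L / 2 * frob_inner v v * t ^+ 2.
pose dphi t : R := s * frob_inner (gradient f (x + t *: v) - g) v
  - L * frob_inner v v * t.
have phiD (t : R) : is_derive t 1 phi (dphi t).
  have h := is_derive_line f x v t (f_diff _).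
  rewrite gradientP // in h.
  rewrite /dphi frob_innerDl frob_innerNl.
  exact: is_derive_quadratic h.
have phi_cont : {within `[0, 1], continuous phi}.
  by apply: derivable_within_continuous => t _; exact: ex_derive.
have [t t01] := MVT ltr01 (fun t _ => phiD t) phi_cont.
have /andP[t0 _] : 0 < t < 1 by move: t01; rewrite in_itv.
rewrite /phi !scale1r !scale0r addr0 subr0 mulr1 => phi01.
have : dphi t <= 0.
  rewrite /dphi subr_le0; apply: (@le_trans _ _
    (`|s| * (frob_norm (gradient f (x + t *: v) - g) * frob_norm v))).
    by rewrite -frob_innerZl mulrA -frob_normZ cauchy_schwarz_frob.
  rewrite s1 mul1r.
  have vE : x + t *: v - x = t *: v by rewrite addrC addKr.
  have := f_smooth (x + t *: v) x; rewrite vE frob_normZ (gtr0_norm t0) => hs.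
  apply: (le_trans (ler_wpM2r (frob_norm_ge0 v) hs)).
  by rewrite -sqr_frob_norm; lra.
lra.
Qed.

(** * Preconditioners *)

(** Reduces the action on matrices to the quadratic forms on vectors in terms of
    which the Loewner order is defined. *)
Lemma frob_inner_mulmx {R : realType} {m n : nat} (A : 'M[R]_m)
    (U : 'M[R]_(m, n)) :
  frob_inner (A *m U) U = \sum_j quad_form A (col j U).
Proof.
rewrite /frob_inner mxtrace_mulC mulmxA /mxtrace; apply: eq_bigr => j _.
rewrite /quad_form tr_col -row_mul !mxE.
by apply: eq_bigr => i _; rewrite !mxE.
Qed.

Lemma spd_unitmx {R : realType} {m : nat} (P : 'M[R]_m) : spd P -> P \in unitmx.
Proof.
move=> [_ Ppos]; rewrite unitmxE unitfE; apply/negP => /det0P[v v0 vP].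
have := Ppos v^T; rewrite trmx_eq0 => /(_ v0).
by rewrite /quad_form trmxK vP mul0mx mxE ltxx.
Qed.

Lemma loewner_le_frob {R : realType} {m n : nat} (A B : 'M[R]_m)
    (U : 'M[R]_(m, n)) : loewner_le A B ->
  frob_inner (A *m U) U <= frob_inner (B *m U) U.
Proof.
move=> [_ AB]; rewrite -subr_ge0 -frob_innerNl -frob_innerDl -mulNmx -mulmxDl.
by rewrite frob_inner_mulmx; apply: sumr_ge0 => j _.
Qed.

(** This is the inequality P^2 <= p P, which follows from 0 <= P <= p I. It
    comes without a square root of P by evaluating the nonnegative form of P at
    p U - P U, which gives p^2 <PU,U> - 2 p <PU,PU> + <P(PU),PU> >= 0, and
    bounding the last term by p <PU,PU>. *)
Lemma loewner_sqr_frob {R : realType} {m n : nat} (P : 'M[R]_m) (p : R)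
    (U : 'M[R]_(m, n)) : P \is symmetricmx -> 0 < p ->
    (forall V : 'M[R]_(m, n), 0 <= frob_inner (P *m V) V) ->
    loewner_le P p%:M ->
  frob_inner (P *m U) (P *m U) <= p * frob_inner (P *m U) U.
Proof.
move=> Psym p0 Ppsd Ple; set g := P *m U.
have gP : frob_inner (P *m g) U = frob_inner g g.
  rewrite /frob_inner {2}/g trmx_mul.
  have -> : P^T = P.
    move: Psym; rewrite qualifE /= => /eqP {2}->.
    by rewrite expr0 scale1r map_mx_id.
  by rewrite -[P *m g *m _]mulmxA mxtrace_mulC mulmxA.
have := Ppsd (p *: U - g); rewrite mulmxBr -scalemxAr -/g !frob_bilinear gP.
have := loewner_le_frob _ _ g Ple; rewrite mul_scalar_mx frob_innerZl => h1 h2.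
have : 0 <= p * (p * frob_inner g U - frob_inner g g) by lra.
by rewrite pmulr_rge0 // subr_ge0.
Qed.

(** * Geometric decay from a Lyapunov inequality *)

Lemma lyapunov_geometric {R : realType} (V e : nat -> R) (K delta : R) :
    0 < K -> 0 < delta -> (forall k, 0 <= e k) ->
    (forall k, V k.+1 + delta * e k <= V k) -> (forall k, V k <= K * e k) ->
  exists rho : R, 0 < rho < 1 /\ forall k, V k <= V 0%N * rho ^+ k.
Proof.
move=> K0 d0 e0 Vdec VK.
have Kd : 0 < K + delta by rewrite addr_gt0.
(* The hypotheses give the factor 1 - delta / K, which can only be positive if
   delta < K; the larger factor K / (K + delta) always lies in (0, 1). *)
exists (K / (K + delta)); split.
  by rewrite divr_gt0 //= ltr_pdivrMr // mul1r ltrDl.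
elim=> [|k IH]; first by rewrite expr0 mulr1.
rewrite exprSr mulrA.
apply: (@le_trans _ _ (V k * (K / (K + delta)))); last first.
  by rewrite ler_wpM2r // divr_ge0 ?ltW.
rewrite mulrA ler_pdivlMr //.
have ek := mulr_ge0 (ltW d0) (e0 k).
have h1 : 0 <= K * (V k - V k.+1 - delta * e k).
  by apply: mulr_ge0; [exact: ltW | have := Vdec k; lra].
have h2 : 0 <= delta * (V k - V k.+1).
  by apply: mulr_ge0; [exact: ltW | have := Vdec k; lra].
have h3 : 0 <= delta * (K * e k - V k).
  by apply: mulr_ge0; [exact: ltW | rewrite subr_ge0].
lra.
Qed.

(** * One step of the iteration *)

(** The energy inequality with vectors replaced by their squared norms [gg],
    [dd], [uu] and inner products [gd], [gu], [du]. By
    [gg <= pmax * gu], half of the descent term [a * gu] dominates the [gg] part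
    of the cross term [b * gd] because b <= 1 / (2 pmax), leaving a quarter of
    a gg / pmax as decrease. By [pmin * uu <= gu], the other half is split
    evenly between the smoothness term in [uu] (because L a <= pmin / 2) and
    the [uu] part of the kinetic term (because its weight is pmin / 8). What
    remains is a multiple of [dd], whose coefficient is at most -pmin / (32 a)
    because b <= pmin / (16 + 4 pmin). *)
Lemma lyapunov_arith {R : realType}
    (L pmin pmax a b F0 F1 gg gd gu dd du uu : R) :
    0 < L -> 0 < pmin -> 0 < pmax -> 0 < a -> 0 <= b ->
    b * (16 + 4 * pmin) <= pmin -> b * (2 * pmax) <= 1 -> L * a <= pmin / 2 ->
    0 <= gg -> 0 <= dd -> 0 <= uu ->
    gg <= pmax * gu -> pmin * uu <= gu ->
    2 * (a * gd) <= a ^+ 2 * gg + dd ->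
    - (2 * (a * b * du)) <= a ^+ 2 * uu + b ^+ 2 * dd ->
    F1 <= F0 + b * gd - a * gu + L / 2 * (b ^+ 2 * dd)
      + L / 2 * (a ^+ 2 * uu) ->
  F1 + pmin / (8 * a) * (b ^+ 2 * dd - 2 * (a * b * du) + a ^+ 2 * uu)
    + (a / (4 * pmax) * gg + pmin / (32 * a) * dd)
    <= F0 + pmin / (8 * a) * dd.
Proof.
move=> L0 pm0 pM0 a0 b0 b1 b2 La gg0 dd0 uu0 hgg huu hgd hdu hF.
have b4 : b <= 1 / 4 by rewrite -(ler_pM2r pm0); have := b0; lra.
(* In terms of D, [a * gg] and [a * uu], the coefficients depend on [a] only
   through [L * a]. *)
pose D := dd / a; have ddE : dd = a * D by rewrite /D mulrC divfK ?gt_eqF.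
have D0 : 0 <= D by rewrite divr_ge0 // ltW.
have hgd' : b * gd <= b * ((a * gg + D) / 2).
  apply: ler_wpM2l => //; rewrite -(ler_pM2l a0); rewrite ddE in hgd.
  lra.
have hdu' : - (2 * (b * du)) <= a * uu + b ^+ 2 * D.
  by rewrite -(ler_pM2l a0); rewrite ddE in hdu; lra.
have e1 : pmin / (8 * a) * (b ^+ 2 * dd - 2 * (a * b * du) + a ^+ 2 * uu) =
   pmin / 8 * (b ^+ 2 * D - 2 * (b * du) + a * uu).
  by rewrite ddE; field; rewrite gt_eqF.
have e2 : pmin / (8 * a) * dd = pmin / 8 * D.
  by rewrite ddE; field; rewrite gt_eqF.
have e3 : pmin / (32 * a) * dd = pmin / 32 * D.
  by rewrite ddE; field; rewrite gt_eqF.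
have e4 : a / (4 * pmax) * gg = a * (gg / pmax) / 4 by field; rewrite gt_eqF.
rewrite e1 e2 e3 e4.
have hgg' : a * (gg / pmax) <= a * gu.
  by rewrite ler_pM2l // ler_pdivrMr // mulrC.
have huu' : a * (pmin * uu) <= a * gu by rewrite ler_pM2l.
have hG : b * (a * gg) <= a * (gg / pmax) / 2.
  rewrite [_ / 2](_ : _ = a * gg * (1 / (2 * pmax))); last first.
    by field; rewrite gt_eqF.
  rewrite (mulrC b); apply: ler_wpM2l; first by rewrite mulr_ge0 // ltW.
  by rewrite ler_pdivlMr // mulr_gt0.
have hLU : L * a * (a * uu) <= pmin / 2 * (a * uu).
  by apply: ler_wpM2r => //; rewrite mulr_ge0 // ltW.
have bb : b ^+ 2 <= b / 4 by rewrite expr2 ler_wpM2l //; lra.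
have hLD : L * a * (b ^+ 2 * D) <= pmin / 2 * (b / 4 * D).
  apply: (@le_trans _ _ (pmin / 2 * (b ^+ 2 * D))).
    by apply: ler_wpM2r => //; rewrite mulr_ge0 ?sqr_ge0.
  by apply: ler_wpM2l; [rewrite divr_ge0 // ltW | apply: ler_wpM2r].
have hbD : b * (16 + 4 * pmin) * D <= pmin * D by rewrite ler_wpM2r.
have hb2D : pmin * (b ^+ 2 * D) <= pmin * (1 / 16 * D).
  by rewrite ler_pM2l // ler_wpM2r //; lra.
have hC : pmin * (- (2 * (b * du))) <= pmin * (a * uu + b ^+ 2 * D).
  by rewrite ler_pM2l.
have hpD : 0 <= pmin * D by rewrite mulr_ge0 // ltW.
have hbpD : 0 <= b * (pmin * D) by rewrite mulr_ge0.
have hF' : F1 <= F0 + b * gd - a * gu + (L * a * (b ^+ 2 * D)) / 2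
    + (L * a * (a * uu)) / 2.
  by apply: (le_trans hF); rewrite ddE; lra.
lra.
Qed.

(** The smoothness estimate between x_k and x_{k+1} passes through y_k, where
    the gradient is evaluated: the upper Taylor bound at y_k bounds f (x_{k+1})
    and the lower one bounds f (y_k) by f (x_k). *)
Lemma nesterov_step {R : realType} {m n : nat} (f : 'M[R]_(m, n) -> R)
    (L pmin pmax a b : R)
    (f_diff : forall x : 'M[R]_(m, n), differentiable f x)
    (f_smooth : forall x y,
       frob_norm (gradient f x - gradient f y) <= L * frob_norm (x - y))
    (P : 'M[R]_m) (x d y x' : 'M[R]_(m, n)) :
    0 < L -> 0 < pmin -> 0 < pmax -> 0 < a -> 0 <= b ->
    b * (16 + 4 * pmin) <= pmin -> b * (2 * pmax) <= 1 -> L * a <= pmin / 2 ->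
    spd P -> loewner_le pmin%:M P -> loewner_le P pmax%:M ->
    y = x + b *: d -> x' = y - a *: (invmx P *m gradient f y) ->
  f x' + pmin / (8 * a) * frob_inner (x' - x) (x' - x)
    + (a / (4 * pmax) * frob_inner (gradient f y) (gradient f y)
       + pmin / (32 * a) * frob_inner d d)
    <= f x + pmin / (8 * a) * frob_inner d d.
Proof.
move=> L0 pm0 pM0 a0 b0 b1 b2 La Pspd Plo Phi yE x'E.
set g := gradient f y; set u := invmx P *m g.
have gE : P *m u = g by rewrite /u mulKVmx // spd_unitmx.
have Plo_frob (V : 'M[R]_(m, n)) :
    pmin * frob_inner V V <= frob_inner (P *m V) V.
  by have := loewner_le_frob _ _ V Plo; rewrite mul_scalar_mx frob_innerZl.
have huu := Plo_frob u; rewrite gE in huu.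
have hgg : frob_inner g g <= pmax * frob_inner g u.
  rewrite -gE; apply: loewner_sqr_frob => //; first by case: Pspd.
  move=> V; apply: le_trans (Plo_frob V).
  by apply: mulr_ge0; [exact: ltW | exact: frob_inner_ge0].
have fx' := smooth_taylor f L 1 f_diff f_smooth (normr1 R) y (- (a *: u)).
have fx := smooth_taylor f L (-1) f_diff f_smooth (normrN1 R) y (- (b *: d)).
have xE : y - b *: d = x by rewrite yE addrK.
rewrite -/g -x'E in fx'; rewrite -/g xE in fx.
have dE : x' - x = b *: d - a *: u.
  rewrite x'E -/g -/u [X in X - _ - _ = _]yE; move: (b *: d) (a *: u) => p q.
  by rewrite addrAC [x + p]addrC addrK.
have -> : frob_inner (x' - x) (x' - x) = b ^+ 2 * frob_inner d d
    - 2 * (a * b * frob_inner d u) + a ^+ 2 * frob_inner u u.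
  by rewrite dE !frob_bilinear (frob_innerC u d); ring.
(* Young's inequality for <g, d> is taken at scale [a], in line with the weight
   1 / a of the kinetic term. *)
have gd := frob_inner_young (a *: g) d.
have du := frob_inner_young (a *: u) (- (b *: d)).
rewrite !frob_bilinear in fx fx' gd du; rewrite (frob_innerC u d) in du.
apply: (lyapunov_arith L pmin pmax a b _ _ _ (frob_inner g d)
  (frob_inner g u)) => //; rewrite ?frob_inner_ge0 //; lra.
Qed.

(** * Linear convergence *)

Theorem corollary3 (R : realType) (m n : nat) (m_gt0 : (0 < m)%N)
    (le_mn : (m <= n)%N) (f : 'M[R]_(m, n) -> R) (L mu fstar : R)
    (L_gt0 : 0 < L) (mu_gt0 : 0 < mu)
    (f_diff : forall x : 'M[R]_(m, n), differentiable f x)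
    (f_smooth : forall x y,
       frob_norm (gradient f x - gradient f y) <= L * frob_norm (x - y))
    (f_proper : proper_map f)
    (f_ge : forall x, fstar <= f x)
    (f_attained : exists x, f x = fstar)
    (f_PL : forall x, mu * (f x - fstar) <= frob_norm (gradient f x) ^+ 2)
    (pmin pmax : R) (pmin_gt0 : 0 < pmin) (pmin_lt_pmax : pmin < pmax) :
  exists (betastar : R) (alphastar : R -> R),
    [/\ 0 < betastar < 1,
        forall beta : R, 0 <= beta < betastar -> 0 < alphastar beta
      & forall beta alpha : R,
          0 <= beta < betastar -> 0 < alpha < alphastar beta ->
        forall (P : nat -> 'M[R]_m) (xm1 : 'M[R]_(m, n))
               (x y : nat -> 'M[R]_(m, n)),
          (forall k, spd (P k)) ->
          (forall k, loewner_le pmin%:M (P k) /\ loewner_le (P k) pmax%:M) ->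
          nesterov_run f alpha beta P xm1 x y ->
        frob_norm (gradient f (y k)) @[k --> \oo] --> (0 : R) /\
        exists C rho : R, [/\ 0 < C, 0 < rho < 1
          & forall k : nat, f (x k) - fstar <= C * rho ^+ k]].
Proof.
have pmax_gt0 : 0 < pmax by exact: lt_trans pmin_lt_pmax.
have den_gt0 : 0 < 16 + 4 * pmin by lra.
(* The first threshold is below 1/4, so the minimum is below 1. *)
exists (Num.min (pmin / (16 + 4 * pmin)) (1 / (2 * pmax))),
  (fun=> pmin / (2 * L)).
split.
- rewrite lt_min !divr_gt0 ?mulr_gt0 //= gt_min ltr_pdivrMr //.
  by apply/orP; left; lra.
- by move=> b _; rewrite divr_gt0 ?mulr_gt0.
move=> b a /andP[b0]; rewrite lt_min ltr_pdivlMr // ltr_pdivlMr ?mulr_gt0 //.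
move=> /andP[b1 b2] /andP[a0]; rewrite ltr_pdivlMr ?mulr_gt0 // => La.
move=> P xm1 x y Pspd Pb run.
pose d k := x k - prev_iterate xm1 x k.
pose c := pmin / (8 * a).
pose V k := f (x k) - fstar + c * frob_inner (d k) (d k).
pose gg k := frob_inner (gradient f (y k)) (gradient f (y k)).
pose e k := gg k + frob_inner (d k) (d k).
pose delta := Num.min (a / (4 * pmax)) (pmin / (32 * a)).
have c0 : 0 < c by rewrite divr_gt0 ?mulr_gt0.
have delta0 : 0 < delta by rewrite lt_min !divr_gt0 ?mulr_gt0.
have gg0 k : 0 <= gg k by exact: frob_inner_ge0.
have dd0 k : 0 <= frob_inner (d k) (d k) by exact: frob_inner_ge0.
have e0 k : 0 <= e k by rewrite addr_ge0.
have fV k : f (x k) - fstar <= V k by rewrite lerDl mulr_ge0 // ltW.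
have V0 k : 0 <= V k by apply: le_trans (fV k); rewrite subr_ge0.
have Vdec k : V k.+1 + delta * e k <= V k.
  have [yE xE] := run k; have [Plo Phi] := Pb k.
  have /= := nesterov_step f L pmin pmax a b f_diff f_smooth (P k) (x k) (d k)
    (y k) (x k.+1) L_gt0 pmin_gt0 pmax_gt0 a0 b0 (ltW b1) (ltW b2)
    _ (Pspd k) Plo Phi yE xE.
  have -> : L * a <= pmin / 2 by lra.
  move=> /(_ isT).
  have : delta * gg k <= a / (4 * pmax) * gg k.
    by rewrite ler_wpM2r // ge_min lexx.
  have : delta * frob_inner (d k) (d k) <=
      pmin / (32 * a) * frob_inner (d k) (d k).
    by rewrite ler_wpM2r // ge_min lexx orbT.
  rewrite /V /e -/(gg k) -/c -[x k.+1 - x k]/(d k.+1).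
  lra.
pose K := 2 / mu * (1 + L ^+ 2) + c.
have K0 : 0 < K.
  by rewrite addr_gt0 // mulr_gt0 ?divr_gt0 // addr_gt0 ?exprn_gt0.
(* The inequality for f holds at x_k while the decrease involves the gradient at
   y_k; the Lipschitz bound transfers one to the other at the cost of |d k|. *)
have VK k : V k <= K * e k.
  have b_le1 : b <= 1.
    rewrite -(ler_pM2r den_gt0); have := mulr_ge0 b0 (ltW pmin_gt0).
    lra.
  set h := gradient f (x k) - gradient f (y k).
  have hh : frob_inner h h <= L ^+ 2 * frob_inner (d k) (d k).
    have -> : L ^+ 2 * frob_inner (d k) (d k) = (L * frob_norm (d k)) ^+ 2.
      by rewrite exprMn sqr_frob_norm.
    rewrite -sqr_frob_norm ler_sqr ?nnegrE ?mulr_ge0 ?frob_norm_ge0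
      ?(ltW L_gt0) //.
    apply: (le_trans (f_smooth _ _)).
    have -> : x k - y k = (- b) *: d k.
      by have [-> _] := run k; rewrite opprD addrA subrr add0r scaleNr.
    rewrite frob_normZ.
    by rewrite normrN ger0_norm // ler_pM2l // ler_piMl ?frob_norm_ge0.
  have hx : frob_norm (gradient f (x k)) ^+ 2 <= 2 * gg k + 2 * frob_inner h h.
    rewrite sqr_frob_norm.
    have -> : gradient f (x k) = gradient f (y k) + h by rewrite /h addrC subrK.
    exact: frob_inner_addr_le.
  have hPL : f (x k) - fstar <= 2 / mu * ((1 + L ^+ 2) * e k).
    rewrite mulrAC ler_pdivlMr // mulrC (le_trans (f_PL _)) // (le_trans hx) //.
    have := mulr_ge0 (sqr_ge0 L) (gg0 k); have := dd0 k; rewrite /e; lra.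
  have := mulr_ge0 (ltW c0) (gg0 k).
  rewrite /V /K /e in hPL *; lra.
have [rho [rho01 Vrho]] := lyapunov_geometric V e K delta K0 delta0 e0 Vdec VK.
have [rho0 rho1] := andP rho01.
split; last first.
  exists (V 0%N + 1), rho; split=> //; first by rewrite ltr_wpDl.
  move=> k; apply: (le_trans (fV k)); apply: (le_trans (Vrho k)).
  by rewrite ler_wpM2r ?exprn_ge0 ?ltW // ltrDl.
have gg_cvg : gg k @[k --> \oo] --> (0 : R).
  have geo : geometric (V 0%N / delta) rho k @[k --> \oo] --> (0 : R).
    by apply: cvg_geometric; rewrite gtr0_norm.
  apply: (squeeze_cvgr _ (cvg_cst (0 : R)) geo).
  apply: nearW => k; rewrite gg0 /= mulrAC ler_pdivlMr // mulrC.
  apply: le_trans (Vrho k); apply: le_trans (Vdec k).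
  apply: (@le_trans _ _ (delta * e k)); last by rewrite lerDr.
  by rewrite ler_pM2l // lerDl.
have := continuous_cvg _ (@sqrt_continuous R 0) gg_cvg.
by rewrite sqrtr0 => sqrt_cvg; exact: sqrt_cvg.
Qed.
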